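(* Let $\mathcal{P}=[0,1]^n\cap K$ be a polytope, where $K$ is an affine subspace of $\mathbb{R}^n$. Then there exists a combinatorial Bernoulli factory for $\mathcal{P}$ which terminates almost surely everywhere on $\mathcal{P}$, including on the boundary of $[0,1]^n$.
   Context: A (multiparameter) Bernoulli factory with input $(p_1,\dots,p_n)$ is a (possibly infinite) rooted binary tree in which every node has either $2$ children or $0$ children (leaf). Each internal node is labelled either by an index $i\in[n]$ or by a constant $c\in(0,1)$; each leaf is labelled $0$ or $1$. To execute it with coins $p\in[0,1]^n$, start at the root; at a node labelled $i$ draw a fresh independent Bernoulli($p_i$) sample, at a node labelled $c$ a fresh independent Bernoulli($c$) sample; move to the child corresponding to the outcome; upon reaching a leaf output its label. It implements $f:\mathcal{P}\to[0,1]$ if for every $p\in\mathcal{P}$ it reaches a leaf almost surely and outputs $1$ with probability exactly $f(p)$. A combinatorial Bernoulli factory for $\mathcal{P}$, with vertex set $V(\mathcal{P})$, is a collection of $|V(\mathcal{P})|$ multiparameter Bernoulli factories implementing functions $f_v:\mathcal{P}\to[0,1]$, $v\in V(\mathcal{P})$, such that for all $p\in\mathcal{P}$: $\sum_{v\in V(\mathcal{P})}f_v(p)=1$ and $\sum_{v\in V(\mathcal{P})}v\,f_v(p)=p$ (so that it can be used to sample a random vertex $v$ with $\mathbb{E}_p[v]=p$). *)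

(* Defs.v *)
From HB Require Import structures.
From mathcomp Require Import all_boot all_order all_algebra.
From mathcomp Require Import all_classical all_reals all_analysis.
Set Implicit Arguments. Unset Strict Implicit. Unset Printing Implicit Defensive.
Import Order.TTheory GRing.Theory Num.Theory.
Import numFieldNormedType.Exports.
Local Open Scope classical_set_scope.
Local Open Scope ring_scope.

Inductive bf_label (R : Type) (n : nat) :=
| BIdx of 'I_n      (* internal node: flip coin p_i *)
| BConst of R       (* internal node: flip a Bernoulli(c) coin *)
| BLeaf of bool.

(* A (possibly infinite) rooted binary tree: node addressed by the string of
   outcomes leading to it from the root (true = outcome 1). Only strings all of
   whose proper prefixes are internal nodes belong to the tree; labels of other
   strings are irrelevant (they get reach probability 0 below). *)
Definition bf_tree (R : Type) (n : nat) := seq bool -> bf_label R n.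

Definition bf_wf (R : realType) n (T : bf_tree R n) :=
  forall s c, T s = BConst n c -> 0 < c < 1.

Definition step_prob (R : realType) n (p : 'rV[R]_n) (l : bf_label R n) (b : bool) : R :=
  match l with
  | BIdx i => if b then p 0 i else 1 - p 0 i
  | BConst c => if b then c else 1 - c
  | BLeaf _ => 0
  end.

Definition reach (R : realType) n (T : bf_tree R n) (p : 'rV[R]_n) (s : seq bool) : R :=
  \prod_(i < size s) step_prob p (T (take i s)) (nth false s i).

Definition stop_mass (R : realType) n (T : bf_tree R n) (p : 'rV[R]_n) (k : nat) : R :=
  \sum_(t : k.-tuple bool) reach T p t * (if T t is BLeaf _ then 1 else 0).
Definition out1_mass (R : realType) n (T : bf_tree R n) (p : 'rV[R]_n) (k : nat) : R :=
  \sum_(t : k.-tuple bool) reach T p t * (if T t is BLeaf true then 1 else 0).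

Definition bf_terminates (R : realType) n (T : bf_tree R n) (p : 'rV[R]_n) :=
  series (stop_mass T p) @ \oo --> (1 : R).

Definition bf_implements (R : realType) n (T : bf_tree R n) (f : 'rV[R]_n -> R)
    (P : set 'rV[R]_n) :=
  bf_wf T /\ forall p, P p -> bf_terminates T p /\ series (out1_mass T p) @ \oo --> f p.

Definition unit_cube (R : realType) n : set 'rV[R]_n :=
  [set p | forall i, 0 <= p 0 i <= 1].

Definition affine_subspace (R : realType) n (K : set 'rV[R]_n) :=
  forall x y (t : R), K x -> K y -> K ((1 - t) *: x + t *: y).

Definition is_vertex (R : realType) n (P : set 'rV[R]_n) (v : 'rV[R]_n) :=
  P v /\ forall x y (t : R), P x -> P y -> 0 < t < 1 ->
    v = (1 - t) *: x + t *: y -> x = v /\ y = v.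

(* Main.v *)
Require Import Defs.
From HB Require Import structures.
From mathcomp Require Import all_boot all_order all_algebra.
From mathcomp Require Import all_classical all_reals all_analysis.
From mathcomp Require Import ring lra.
Import Order.TTheory GRing.Theory Num.Theory.
Import numFieldNormedType.Exports.
Local Open Scope classical_set_scope.
Local Open Scope ring_scope.

(** For a vertex v let w_v(p) be the product over i of 1 - p_i if v_i = 0, of p_i if
v_i = 1, and of p_i (1 - p_i) otherwise.  Then psi_v(p) = p + w_v(p) (p - v) stays in P, and
its coordinates are simulated by finite trees flipping the coins p_i.  The factory draws v at
random from a fixed distribution on the vertices; with probability 1/2 it tests the event of
probability w_v(p), outputs v on success and restarts on failure, and with probability 1/2 it
restarts with simulated coins for psi_v(p) in place of those for p.  Each round preserves the
mean, since (w_v v + (1 - w_v) p) / 2 + psi_v(p) / 2 = p.  Every point of P is close enough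
to some vertex v for w_v to be bounded below on it by a constant depending on P only, so each
round stops with probability bounded below, on the boundary too. *)

Set Implicit Arguments. Unset Strict Implicit. Unset Printing Implicit Defensive.

(** * Vertices of the polytope: finiteness and proximity *)

Definition tight {R : realType} {n : nat} (p : 'rV[R]_n) (i : 'I_n) : bool :=
  (p 0 i == 0) || (p 0 i == 1).

(** Move from [p] both ways along [d] at equal speed and stop when the first coordinate of either
    moving point hits 0 or 1. *)
Lemma exit_cube (R : realType) (n : nat) (p d : 'rV[R]_n) :
  unit_cube p -> d != 0 -> (forall i, tight p i -> d 0 i = 0) ->
  exists2 s : R, 0 < s &
    [/\ unit_cube (p + s *: d), unit_cube (p - s *: d) &
        exists i, ~~ tight p i /\ (tight (p + s *: d) i || tight (p - s *: d) i)].
Proof.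
move=> cp dN0 td.
have [i0 di0] : exists i, d 0 i != 0.
  apply/existsP; rewrite -negb_forall; apply: contra dN0 => /forallP d0.
  by apply/eqP/rowP => i; rewrite mxE; apply/eqP.
(* [r i] is the step at which coordinate [i] of one of the two moving points reaches 0 or 1; the
   smallest one is used. *)
pose r (i : 'I_n) : R := Num.min (p 0 i) (1 - p 0 i) / `|d 0 i|.
case: (@Order.TotalTheory.arg_minP _ _ _ i0 (fun i => d 0 i != 0) r di0) => i di min_i.
have ti : ~~ tight p i by apply: contra di => /td ->.
have r0 : 0 < r i.
  rewrite divr_gt0 ?normr_gt0// lt_min subr_gt0.
  have /andP[p0 p1] := cp i; move: ti; rewrite negb_or => /andP[pn0 pn1].
  by rewrite lt_def pn0 p0 lt_neqAle pn1 p1.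
have bd j : `|r i * d 0 j| <= Num.min (p 0 j) (1 - p 0 j).
  have [->|dj] := eqVneq (d 0 j) 0.
    by rewrite mulr0 normr0 le_min subr_ge0; apply: cp.
  rewrite normrM gtr0_norm// -ler_pdivlMr ?normr_gt0//; exact: min_i.
exists (r i) => //; split.
- move=> j; have := bd j; rewrite !mxE le_min !ler_norml => /andP[]; lra.
- move=> j; have := bd j; rewrite !mxE le_min !ler_norml => /andP[]; lra.
exists i; split=> //; rewrite /tight !mxE.
have e : `|r i * d 0 i| = Num.min (p 0 i) (1 - p 0 i).
  by rewrite normrM gtr0_norm// /r divfK// normr_eq0.
(* Four cases: which of 0 and 1 is nearer to [p 0 i], and the sign of [d 0 i]. *)
move: e; rewrite minEle; case: ifP => _ /eqP; rewrite eqr_norml => /andP[/orP[]/eqP-> _].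
- by rewrite subrr eqxx orbT.
- by rewrite subrr eqxx.
- by rewrite addrCA subrr addr0 eqxx orbT.
- by rewrite opprK addrCA subrr addr0 eqxx !orbT.
Qed.

Section Vertices.
Variables (R : realType) (n : nat) (K : set 'rV[R]_n).
Hypothesis affK : affine_subspace K.
Let P := @unit_cube R n `&` K.

Lemma affine_line (x y p : 'rV[R]_n) (s : R) :
  K x -> K y -> K p -> K (p + s *: (y - x)).
Proof.
move=> Kx Ky Kp.
(* Starting from [x], going twice as far as the midpoint of [p] and [x + s *: (y - x)] lands on the
   required point. *)
have Kz := affK 2^-1 Kp (affK s Kx Ky).
have := affK 2 Kx Kz; congr K; apply/rowP => i; rewrite !mxE. by field.
Qed.

(** A strict convex combination of cube points can have a coordinate 0 or 1 only if both points
    share it. *)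
Lemma nonvertex_dir (p : 'rV[R]_n) : P p -> ~ is_vertex P p ->
  exists x y, [/\ K x, K y, y - x != 0 & forall i, tight p i -> (y - x) 0 i = 0].
Proof.
move=> Pp nv; apply: contrapT => nd; apply: nv; split=> // x y t Px Py t01 pE.
have [xy|xNy] := eqVneq (y - x) 0.
  by move/subr0_eq: xy pE => ->; rewrite -scalerDl subrK scale1r.
case: nd; exists x, y; split; [exact: Px.2|exact: Py.2|by []|move=> i].
have /andP[x0 x1] := Px.1 i; have /andP[y0 y1] := Py.1 i.
have /andP[t0 t1] := t01.
have := congr1 (fun v : 'rV[R]_n => v 0 i) pE; rewrite /= !mxE => pEi.
move=> /orP[] /eqP pi.
- have xi : x 0 i = 0 by nra.
  have yi : y 0 i = 0 by nra.
  by rewrite xi yi subrr.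
- have xi : x 0 i = 1 by nra.
  have yi : y 0 i = 1 by nra.
  by rewrite xi yi subrr.
Qed.

(** Take for [q] an exit point of the cube: tight coordinates stay tight and one more becomes so.
    The opposite point [2 p - q] also lies in the cube, whence the factor 2. *)
Lemma nonvertex_split (p : 'rV[R]_n) : P p -> ~ is_vertex P p ->
  exists q, [/\ P q, (#|[pred i | ~~ tight q i]| < #|[pred i | ~~ tight p i]|)%N &
    forall i, q 0 i <= 2 * p 0 i /\ 1 - q 0 i <= 2 * (1 - p 0 i)].
Proof.
move=> Pp nv; have [x [y [Kx Ky dN0 td]]] := nonvertex_dir Pp nv.
have [s s0 [cp cm [i [ti ti']]]] := exit_cube Pp.1 dN0 td.
(* Covers both exit points at once, with [s'] equal to [s] or [- s]. *)
have main s' : unit_cube (p + s' *: (y - x)) -> unit_cube (p - s' *: (y - x)) ->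
    tight (p + s' *: (y - x)) i ->
    exists q, [/\ P q, (#|[pred i | ~~ tight q i]| < #|[pred i | ~~ tight p i]|)%N &
      forall i, q 0 i <= 2 * p 0 i /\ 1 - q 0 i <= 2 * (1 - p 0 i)].
  move=> c1 c2 ti1; exists (p + s' *: (y - x)); split.
  - by split=> //; apply: affine_line => //; exact: Pp.2.
  - apply/proper_card/properP; split; last by exists i; rewrite !inE// negbK.
    apply/fintype.subsetP => j; rewrite !inE; apply: contra => tj.
    by rewrite /tight mxE [X in _ + X]mxE td// mulr0 addr0.
  - move=> j; have := c2 j; have := Pp.1 j; rewrite !mxE.
    by move=> /andP[? ?] /andP[? ?]; split; lra.
case/orP: ti' => ti'; first exact: (main s).
apply: (main (- s)); first by rewrite scaleNr.
  by rewrite scaleNr opprK.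
by rewrite scaleNr.
Qed.

(** Iterate [nonvertex_split]: at most [n] coordinates are free, each split removes one and costs a
    factor 2. *)
Lemma vertex_near (p : 'rV[R]_n) : P p ->
  exists2 v, is_vertex P v &
    forall i, v 0 i <= 2 ^+ n * p 0 i /\ 1 - v 0 i <= 2 ^+ n * (1 - p 0 i).
Proof.
suff H k : forall q, P q -> (#|[pred i | ~~ tight q i]| <= k)%N ->
    exists2 v, is_vertex P v &
    forall i, v 0 i <= 2 ^+ k * q 0 i /\ 1 - v 0 i <= 2 ^+ k * (1 - q 0 i).
  by move=> Pp; apply: H => //; rewrite -[leqRHS]card_ord; exact: max_card.
elim: k => [|k IH] q Pq hk.
all: have [vq|nvq] := pselect (is_vertex P q).
- by exists q => // i; rewrite expr0 !mul1r.
- by have [q' [_ + _]] := nonvertex_split Pq nvq; move/leq_trans => /(_ _ hk).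
- exists q => // i; have /andP[q0 q1] := Pq.1 i.
  by split; rewrite ler_peMl ?subr_ge0// exprn_ege1// ler1n.
have [q' [Pq' lt_q' q'le]] := nonvertex_split Pq nvq.
have [v vP vle] := IH q' Pq' (leq_trans lt_q' hk).
have k0 : 0 <= (2 : R) ^+ k by rewrite exprn_ge0.
exists v => // i; have [v1 v2] := vle i; have [l1 l2] := q'le i.
rewrite exprSr -!mulrA; split; [apply: (le_trans v1)|apply: (le_trans v2)];
  exact: ler_wpM2l.
Qed.

(** Otherwise [w - v] vanishes where [v] is tight, so [v] can move both ways along it and is the
    midpoint of two other points of P. *)
Lemma vertex_tight_inj (v w : 'rV[R]_n) : is_vertex P v -> is_vertex P w ->
  (forall i, (v 0 i == 0) = (w 0 i == 0) /\ (v 0 i == 1) = (w 0 i == 1)) -> v = w.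
Proof.
move=> [Pv vv] [Pw _] vw.
have [/subr0_eq ->//|dN0] := eqVneq (w - v) 0.
have [|s s0 [cp cm _]] := exit_cube Pv.1 dN0.
  move=> i; have [e0 e1] := vw i; rewrite !mxE.
  by case/orP => vi; move: e0 e1; rewrite (eqP vi) eqxx => + + ;
    [move=> /esym/eqP -> _|move=> _ /esym/eqP ->]; rewrite subrr.
have Pline r : unit_cube (v + r *: (w - v)) -> P (v + r *: (w - v)).
  by split=> //; apply: affine_line => //; [exact: Pv.2|exact: Pw.2|exact: Pv.2].
have Pp := Pline s cp.
have Pm : P (v - s *: (w - v)) by rewrite -scaleNr; apply: Pline; rewrite scaleNr.
have t01 : 0 < (2^-1 : R) < 1 by rewrite invr_gt0 ltr0n invf_lt1 ?ltr0n ?ltr1n.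
have vE : v = (1 - 2^-1) *: (v + s *: (w - v)) + 2^-1 *: (v - s *: (w - v)).
  by apply/rowP => i; rewrite !mxE; field.
have [+ _] := vv _ _ _ Pp Pm t01 vE.
move/eqP; rewrite -subr_eq0 addrAC subrr add0r scaler_eq0 (negPf dN0) orbF.
by rewrite gt_eqF.
Qed.

Lemma vertices_enum :
  exists2 vs : seq 'rV[R]_n, uniq vs & forall v, v \in vs <-> is_vertex P v.
Proof.
pose pat (v : 'rV[R]_n) := [ffun i => (v 0 i == 0, v 0 i == 1)].
have pat_inj : {in [set v | is_vertex P v] &, injective pat}.
  move=> v w /set_mem vP /set_mem wP e; apply: vertex_tight_inj vP wP _ => i.
  by have := congr1 (fun a : {ffun 'I_n -> bool * bool} => a i) e; rewrite !ffunE => -[].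
have : finite_set (pat @` [set v | is_vertex P v]) by exact: finite_finset.
rewrite (eq_finite_set (inj_card_eq pat_inj)).
move=> /finite_seqP[s sE]; exists (undup s); first exact: undup_uniq.
move=> v; rewrite mem_undup.
have -> : is_vertex P v = [set v | is_vertex P v] v by [].
by rewrite sE.
Qed.

End Vertices.

(** * Convergence and first-step analysis of the output mass of a tree *)

Section TreeMass.
Variables (R : realType) (n : nat) (p : 'rV[R]_n).
Implicit Types (T : bf_tree R n) (phi : bool -> R).

Definition subtree T (b : bool) : bf_tree R n := fun s => T (b :: s).

(** The payoff [phi] on leaf labels treats [stop_mass] (constant 1) and [out1_mass] (indicator of
    [true]) together. *)
Definition leaf_val phi (l : bf_label R n) : R := if l is BLeaf b then phi b else 0.

Definition mass phi T (k : nat) : R :=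
  \sum_(t : k.-tuple bool) reach T p t * leaf_val phi (T t).

Definition value phi T : R := limn (series (mass phi T)).

Lemma stop_massE T : stop_mass T p = mass (fun=> 1) T.
Proof. by []. Qed.

Lemma out1_massE T : out1_mass T p = mass (fun b => b%:R) T.
Proof.
by apply/funext => k; apply: eq_bigr => t _; congr (_ * _); case: (T t) => [||[]].
Qed.

Lemma reach_cons T b s : reach T p (b :: s) = step_prob p (T [::]) b * reach (subtree T b) p s.
Proof. by rewrite /reach /= big_ord_recl. Qed.

Lemma mass0 phi T : mass phi T 0 = leaf_val phi (T [::]).
Proof.
rewrite /mass (bigD1 [tuple])//= big1 => [|t]; last first.
  by rewrite (_ : t = [tuple]) ?eqxx//; exact: tuple0.
by rewrite addr0 /reach big_ord0 mul1r.
Qed.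

Lemma massS phi T k :
  mass phi T k.+1 = \sum_b step_prob p (T [::]) b * mass phi (subtree T b) k.
Proof.
rewrite /mass; under [RHS]eq_bigr do rewrite big_distrr.
rewrite pair_big/= (reindex (fun x : bool * k.-tuple bool => [tuple of x.1 :: x.2])) /=.
  by apply: eq_bigr => -[b t] _; rewrite reach_cons mulrA.
exists (fun t : k.+1.-tuple bool => (thead t, [tuple of behead t])).
  by move=> [b t] _ /=; congr (_, _); apply: val_inj.
by move=> t _; rewrite [t in RHS]tuple_eta; apply: val_inj.
Qed.

Lemma series_massS phi T k :
  series (mass phi T) k.+1 = leaf_val phi (T [::]) +
    \sum_b step_prob p (T [::]) b * series (mass phi (subtree T b)) k.
Proof.
rewrite /series /= big_nat_recl// mass0; congr (_ + _).
by under eq_bigr do rewrite massS; rewrite exchange_big/=;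
  apply: eq_bigr => b _; rewrite big_distrr.
Qed.

Lemma subtree_wf T b : bf_wf T -> bf_wf (subtree T b).
Proof. by move=> wT s; apply: wT. Qed.

Hypothesis pcube : unit_cube p.

Lemma step_prob_ge0 T b : bf_wf T -> 0 <= step_prob p (T [::]) b.
Proof.
move=> wT; case TE : (T [::]) => [i|c|//] /=.
  by have /andP[] := pcube i; case: b; lra.
by have /andP[] := wT _ _ TE; case: b; lra.
Qed.

Variable phi : bool -> R.
Hypothesis phi01 : forall b, 0 <= phi b <= 1.

Lemma leaf_val_ge0 l : 0 <= leaf_val phi l.
Proof. by case: l => //= b; have /andP[] := phi01 b. Qed.

Lemma mass_ge0 T k : bf_wf T -> 0 <= mass phi T k.
Proof.
elim: k T => [|k IH] T wT; first by rewrite mass0 leaf_val_ge0.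
rewrite massS sumr_ge0// => b _.
by rewrite mulr_ge0 ?step_prob_ge0// IH//; exact: subtree_wf.
Qed.

(** At an internal root the step probabilities sum to 1 and the payoff is 0; at a leaf the payoff is
    at most 1 and the step probabilities vanish. *)
Lemma series_mass_le1 T k : bf_wf T -> series (mass phi T) k <= 1.
Proof.
elim: k T => [|k IH] T wT; first by rewrite /series /= big_geq.
rewrite series_massS.
have le b : step_prob p (T [::]) b * series (mass phi (subtree T b)) k <= step_prob p (T [::]) b.
  by rewrite ler_piMr ?step_prob_ge0// IH//; exact: subtree_wf.
apply: (@le_trans _ _ (leaf_val phi (T [::]) + \sum_b step_prob p (T [::]) b)).
  by rewrite lerD2l ler_sum.
rewrite big_bool; case: (T [::]) => [i|c|b] /=.
- by rewrite add0r addrC subrK.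
- by rewrite add0r addrC subrK.
- by rewrite !addr0; have /andP[] := phi01 b.
Qed.

Lemma is_cvg_mass T : bf_wf T -> cvgn (series (mass phi T)).
Proof.
move=> wT; apply: nondecreasing_is_cvgn.
  by apply: nondecreasing_series => i _ _; apply: mass_ge0.
by exists 1 => _ [k _ <-]; apply: series_mass_le1.
Qed.

Lemma value_bound T : bf_wf T -> 0 <= value phi T <= 1.
Proof.
move=> wT; have cv := is_cvg_mass wT; apply/andP; split.
  by apply: limr_ge => //; near=> k; apply: sumr_ge0 => i _; apply: mass_ge0.
by apply: limr_le => //; near=> k; apply: series_mass_le1.
Unshelve. all: by end_near. Qed.

(** First-step analysis: [series_massS] passed to the limit, after an index shift by one. *)
Lemma valueE T : bf_wf T -> value phi T =
  leaf_val phi (T [::]) + \sum_b step_prob p (T [::]) b * value phi (subtree T b).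
Proof.
move=> wT; apply/cvg_lim => //; rewrite -(cvg_shiftS _) /=.
under eq_cvg do rewrite series_massS big_bool.
rewrite big_bool; apply: cvgD; first exact: cvg_cst.
by apply: cvgD; apply: cvgM; [exact: cvg_cst|apply: is_cvg_mass; exact: subtree_wf
  |exact: cvg_cst|apply: is_cvg_mass; exact: subtree_wf].
Qed.

End TreeMass.

(** * Finite coin-flipping programs and their expectations *)

Section Programs.
Variables (R : realType) (n : nat).

Definition constant := {c : R | 0 < c < 1}.

(** Finite trees only, so that expectations are structural recursions; infinite trees arise from
    repeating a program. *)
Inductive prog (X : Type) :=
| Ret of X
| Flip of 'I_n + constant & (bool -> prog X).

Definition coin_prob (p : 'rV[R]_n) (c : 'I_n + constant) : R :=
  match c with inl i => p 0 i | inr c => val c end.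

Fixpoint bind X Y (m : prog X) (f : X -> prog Y) : prog Y :=
  match m with
  | Ret x => f x
  | Flip c k => Flip c (fun b => bind (k b) f)
  end.

Fixpoint subst X (U : 'I_n -> prog bool) (m : prog X) : prog X :=
  match m with
  | Ret x => Ret x
  | Flip (inl i) k => bind (U i) (fun b => subst U (k b))
  | Flip (inr c) k => Flip (inr c) (fun b => subst U (k b))
  end.

Fixpoint expect X (p : 'rV[R]_n) (m : prog X) (g : X -> R) : R :=
  match m with
  | Ret x => g x
  | Flip c k => coin_prob p c * expect p (k true) g +
                (1 - coin_prob p c) * expect p (k false) g
  end.

Definition prob1 p (m : prog bool) : R := expect p m (fun b => b%:R).

Lemma expect_bind X Y p (m : prog X) (f : X -> prog Y) g :
  expect p (bind m f) g = expect p m (fun x => expect p (f x) g).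
Proof. by elim: m => //= c k IH; rewrite !IH. Qed.

Lemma eq_expect X p (m : prog X) g h : g =1 h -> expect p m g = expect p m h.
Proof. by move=> gh; congr expect; apply/funext. Qed.

Lemma expectD X p (m : prog X) g h :
  expect p m (fun x => g x + h x) = expect p m g + expect p m h.
Proof. by elim: m => //= c k IH; rewrite !IH; ring. Qed.

Lemma expectZ X p (m : prog X) a g :
  expect p m (fun x => a * g x) = a * expect p m g.
Proof. by elim: m => //= c k IH; rewrite !IH; ring. Qed.

Lemma expect_cst X p (m : prog X) a : expect p m (fun=> a) = a.
Proof. by elim: m => //= c k IH; rewrite !IH; ring. Qed.

Lemma expect_sum X p (m : prog X) (I : finType) (g : I -> X -> R) :
  expect p m (fun x => \sum_i g i x) = \sum_i expect p m (g i).
Proof.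
by elim: m => //= c k IH; rewrite !IH !mulr_sumr -big_split.
Qed.

Lemma expect_bool p (m : prog bool) g :
  expect p m g = prob1 p m * g true + (1 - prob1 p m) * g false.
Proof.
rewrite (@eq_expect _ _ _ _ (fun b : bool => g false + (g true - g false) * b%:R)).
  by rewrite expectD expectZ expect_cst /prob1; ring.
by case=> /=; ring.
Qed.

(** Only the bias of a simulated coin matters: under [p], [U i] behaves as a coin of bias
    [q 0 i]. *)
Lemma expect_subst X (p q : 'rV[R]_n) (U : 'I_n -> prog bool) (m : prog X) g :
  (forall i, prob1 p (U i) = q 0 i) -> expect p (subst U m) g = expect q m g.
Proof.
move=> Uq; elim: m => //= -[i|c] k IH /=; last by rewrite !IH.
by rewrite expect_bind expect_bool !IH Uq.
Qed.

Lemma coin_prob_bound p c : unit_cube p -> 0 <= coin_prob p c <= 1.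
Proof. by move=> cp; case: c => [i|[c /= /andP[/ltW-> /ltW->]]]//; apply: cp. Qed.

Lemma le_expect X p (m : prog X) g h : unit_cube p ->
  (forall x, g x <= h x) -> expect p m g <= expect p m h.
Proof.
move=> cp gh; elim: m => //= c k IH; have /andP[c0 c1] := coin_prob_bound c cp.
by rewrite lerD// ler_wpM2l// subr_ge0.
Qed.

Lemma prob1_bound p m : unit_cube p -> 0 <= prob1 p m <= 1.
Proof.
move=> cp; apply/andP; split.
  by rewrite -[leLHS](expect_cst p m); apply: le_expect => // b.
by rewrite -[leRHS](expect_cst p m); apply: le_expect => // -[].
Qed.

(** * Unfolding a repeated program into an infinite tree *)

Section Machine.
Variables (S V : Type) (body : S -> prog (S + V)).

Lemma fair_proof : 0 < (2^-1 : R) < 1.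
Proof. by rewrite invr_gt0 ltr0n invf_lt1 ?ltr0n ?ltr1n. Qed.

Definition fair : constant := exist _ 2^-1 fair_proof.

Definition coin_label (c : 'I_n + constant) : bf_label R n :=
  match c with inl i => BIdx R i | inr c => BConst n (val c) end.

(* A state transition costs one coin flip whose outcome is ignored, so that every
   node of the tree is produced even if [body] loops without flipping. *)
Fixpoint unfold_tree (acc : V -> bool) (m : prog (S + V)) (s : seq bool) : bf_label R n :=
  match m, s with
  | Ret (inr v), _ => BLeaf R n (acc v)
  | Ret (inl _), [::] => BConst n (val fair)
  | Ret (inl x), _ :: s' => unfold_tree acc (body x) s'
  | Flip c _, [::] => coin_label c
  | Flip _ k, b :: s' => unfold_tree acc (k b) s'
  end.

Lemma unfold_tree_wf acc m : bf_wf (unfold_tree acc m).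
Proof.
move=> s c; elim: s m => [|b s IH] [[x|v]|[i|d] k] //=; do ?[exact: IH].
  by move=> [<-]; exact: fair_proof.
by move=> [<-]; exact: (valP d).
Qed.

Variables (p : 'rV[R]_n) (pcube : unit_cube p).
Variables (phi : bool -> R) (phi01 : forall b, 0 <= phi b <= 1) (acc : V -> bool).

Definition run_value (m : prog (S + V)) : R := value p phi (unfold_tree acc m).

Lemma run_value_bound m : 0 <= run_value m <= 1.
Proof. by apply: value_bound => //; exact: unfold_tree_wf. Qed.

Lemma run_value_out v : run_value (Ret (inr v)) = phi (acc v).
Proof.
rewrite /run_value valueE//; last exact: unfold_tree_wf.
by rewrite big_bool /= !mul0r !addr0.
Qed.

Lemma run_valueE m : run_value m = expect p m (fun x => run_value (Ret x)).
Proof.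
elim: m => //= c k IH; rewrite -!IH /run_value valueE//; last exact: unfold_tree_wf.
by rewrite big_bool /=; case: c => [i|c] /=; rewrite add0r.
Qed.

Lemma run_value_state x :
  run_value (Ret (inl x)) = expect p (body x) (fun y => run_value (Ret y)).
Proof.
rewrite -run_valueE {1}/run_value valueE//; last exact: unfold_tree_wf.
(* Both children of the idle fair node unfold [body x], so the two halves add up. *)
rewrite big_bool /= add0r -[value _ _ (subtree _ true)]/(run_value (body x)).
by field.
Qed.

End Machine.

(** Uniqueness principle behind termination, total mass and mean: a bounded [h] that is preserved by
    rounds and zero on outputs shrinks by [1 - eta] per round, because a round continues with at
    most that probability. *)
Lemma expect_fixpoint_eq0 (S V : Type) (body : S -> prog (S + V)) p (eta B : R)
    (h : S + V -> R) : unit_cube p -> 0 < eta ->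
  (forall x, expect p (body x) (fun y => if y is inl _ then 1 else 0) <= 1 - eta) ->
  (forall x, h (inl x) = expect p (body x) h) ->
  (forall v, h (inr v) = 0) -> (forall x, `|h (inl x)| <= B) ->
  forall x, h (inl x) = 0.
Proof.
move=> cp eta0 stay hE h0 hB x.
have eta1 : 0 <= 1 - eta.
  apply: le_trans (stay x); rewrite -[leLHS](expect_cst p (body x)).
  by apply: le_expect => // -[].
have B0 : 0 <= B by apply: le_trans (hB x).
have dec k y : `|h (inl y)| <= B * (1 - eta) ^+ k.
  elim: k y => [|k IH] y; first by rewrite mulr1.
  (* Used for both [h] and its opposite, to bound the absolute value. *)
  have bnd (f : S + V -> R) : (forall z, f z <= `|h z|) ->
      expect p (body y) f <= B * (1 - eta) ^+ k.+1.
    move=> fh; apply: (@le_trans _ _ (expect p (body y)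
      (fun z => B * (1 - eta) ^+ k * (if z is inl _ then 1 else 0)))).
      apply: le_expect => // -[z|v]; first by rewrite mulr1; apply: le_trans (IH z).
      by apply: le_trans (fh _) _; rewrite h0 normr0 mulr0.
    rewrite expectZ exprSr mulrA ler_wpM2l ?mulr_ge0 ?exprn_ge0//; exact: stay.
  rewrite hE ler_norml bnd ?andbT => [|z]; last exact: ler_norm.
  rewrite lerNl -mulN1r -expectZ bnd// => z.
  by rewrite mulN1r -normrN; exact: ler_norm.
have cv : (fun k => B * (1 - eta) ^+ k) @ \oo --> (0 : R).
  rewrite -[X in _ --> X](mulr0 B); apply: cvgM; first exact: cvg_cst.
  by apply: cvg_expr; rewrite ger0_norm//; lra.
apply/eqP; rewrite -normr_le0; rewrite -(cvg_lim _ cv)//.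
by apply: limr_ge; [apply/cvg_ex; exists 0|near=> k; exact: dec].
Unshelve. all: by end_near. Qed.

End Programs.

Arguments Ret {R n X} x.

(** * Pushing a point away from a vertex, and simulating the result *)

Section Push.
Variables (R : realType) (n : nat).
Implicit Types (v q : 'rV[R]_n) (c x : R).

Definition factor c x : R :=
  if 0 < c < 1 then x * (1 - x) else if c == 0 then 1 - x else x.

Definition weight v q : R := \prod_i factor (v 0 i) (q 0 i).

Definition push v q : 'rV[R]_n := q + weight v q *: (q - v).

Definition factor_test c (i : 'I_n) : prog R n bool :=
  if 0 < c < 1 then
    Flip (inl i) (fun b => Flip (inl i) (fun b' => Ret (b && ~~ b')))
  else Flip (inl i) (fun b => Ret (if c == 0 then ~~ b else b)).

Definition product_test v (s : seq 'I_n) : prog R n bool :=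
  foldr (fun i m => bind (factor_test (v 0 i) i) (fun b => if b then m else Ret false))
    (Ret true) s.

(** For [0 < c < 1] the bias is 1/2 + (x - c)/2, where x is the bias of coin [i]. The test
    [insub (1 - c)] recognises this case; for [c] equal to 0 or 1 the answer is deterministic. *)
Definition tie_break c (i : 'I_n) : prog R n bool :=
  if insub (1 - c) is Some d then
    Flip (inr (fair R)) (fun b => if b then Flip (inl i) Ret
                                  else Flip (inr d) Ret)
  else Ret (c == 0).

(* With p = q_i, c = v_i and M = weight v q / factor c p: outputting the common value of
   two coins when they agree and flipping [tie_break] when they differ has probability
   p + factor c p * (p - c), and doing so only with probability M gives push v q. *)
Definition push_coin v (i : 'I_n) : prog R n bool :=
  bind (product_test v [seq k <- index_enum 'I_n | k != i]) (fun ok =>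
    if ok then
      Flip (inl i) (fun b => Flip (inl i) (fun b' =>
        if b == b' then Ret b else tie_break (v 0 i) i))
    else Flip (inl i) Ret).

Lemma prob1_factor_test q c i : prob1 q (factor_test c i) = factor c (q 0 i).
Proof.
rewrite /prob1 /factor_test /factor; case: ifP => _ /=; first ring.
by case: ifP => _ /=; ring.
Qed.

Lemma prob1_product_test q v s :
  prob1 q (product_test v s) = \prod_(i <- s) factor (v 0 i) (q 0 i).
Proof.
elim: s => [|i s IH]; first by rewrite big_nil.
by rewrite big_cons -IH /prob1 /= expect_bind expect_bool prob1_factor_test /=; ring.
Qed.

Lemma prob1_push_coin q v i : unit_cube v -> prob1 q (push_coin v i) = push v q 0 i.
Proof.
move=> vcube; rewrite /prob1 /push_coin expect_bind expect_bool prob1_product_test /=.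
rewrite !mxE big_filter; set M := \prod_(k | k != i) factor (v 0 k) (q 0 k).
have -> : weight v q = factor (v 0 i) (q 0 i) * M by rewrite /weight (bigD1 i).
have -> : expect q (tie_break (v 0 i) i) (fun b => b%:R) =
    if 0 < v 0 i < 1 then 2^-1 * q 0 i + 2^-1 * (1 - v 0 i)
    else if v 0 i == 0 then 1 else 0.
  rewrite /tie_break; case: insubP => [d d01 dE|nd].
    rewrite (_ : 0 < v 0 i < 1) /= ?dE; first by field.
    by move: d01; rewrite subr_gt0 ltrBlDr ltrDl andbC.
  rewrite (_ : (0 < v 0 i < 1) = false) /=; first by case: (v 0 i == 0).
  by apply/negbTE; apply: contra nd; rewrite subr_gt0 ltrBlDr ltrDl andbC.
rewrite /factor; case: ifP => [_|vi]; first by field.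
case: eqP => [->|vi0]; first by ring.
have -> : v 0 i = 1.
  have /andP[v0 v1] := vcube i; apply: contraFeq vi => vi1.
  by rewrite !lt_neqAle vi1 v0 v1 eq_sym; move/eqP: vi0 => ->.
ring.
Qed.

Lemma factor_ge0 c x : 0 <= x <= 1 -> 0 <= factor c x.
Proof. by move=> /andP[x0 x1]; rewrite /factor; do 2?case: ifP => _; nra. Qed.

(** The quadratic factor loses [t] twice; the linear ones lose it once, which is weakened to
    [t ^+ 2] for a uniform exponent. *)
Lemma factor_lower_bound c x t : 0 < t <= 1 -> 0 <= c <= 1 -> t * c <= x ->
  t * (1 - c) <= 1 - x -> t ^+ 2 * factor c c <= factor c x.
Proof.
move=> /andP[t0 t1] /andP[c0 c1] cx cx'; rewrite /factor; case: ifP => [/andP[? ?]|_].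
  rewrite expr2 mulrACA; apply: ler_pM => //; apply: mulr_ge0; lra.
have w y z : 0 <= y -> t * y <= z -> t ^+ 2 * y <= z.
  by move=> y0; apply: le_trans; rewrite expr2 -mulrA ler_piMl// mulr_ge0// ltW.
by case: ifP => _; apply: w => //; rewrite subr_ge0.
Qed.

Lemma factor_diag_gt0 c : 0 <= c <= 1 -> 0 < factor c c.
Proof.
move=> /andP[c0 c1]; rewrite /factor; case: ifP => [/andP[? ?]|c01]; first by nra.
case: eqP => [->|/eqP cN0]; first by rewrite subr0.
by rewrite lt_def cN0.
Qed.

Lemma weight_diag_gt0 v : unit_cube v -> 0 < weight v v.
Proof. by move=> cv; apply: prodr_gt0 => i _; apply: factor_diag_gt0. Qed.

Lemma weight_ge0 v q : unit_cube q -> 0 <= weight v q.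
Proof. by move=> cq; apply: prodr_ge0 => i _; apply: factor_ge0. Qed.

Lemma weight_lower_bound v q t : 0 < t <= 1 -> unit_cube v ->
  (forall i, t * v 0 i <= q 0 i /\ t * (1 - v 0 i) <= 1 - q 0 i) ->
  (t ^+ 2) ^+ n * weight v v <= weight v q.
Proof.
move=> t01 cv vq; have -> : (t ^+ 2) ^+ n = \prod_(i < n) t ^+ 2.
  by rewrite prodr_const card_ord.
rewrite /weight -big_split /=; apply: ler_prod => i _; have [? ?] := vq i.
rewrite factor_lower_bound// andbT mulr_ge0 ?sqr_ge0//.
by apply/ltW/factor_diag_gt0.
Qed.

End Push.

(** * The factory over an enumeration of points of P *)

Section Factory.
Variables (R : realType) (n : nat) (K : set 'rV[R]_n).
Hypothesis affK : affine_subspace K.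
Let P := @unit_cube R n `&` K.
Variables (N : nat) (a : 'I_N.+1 -> 'rV[R]_n).
Hypothesis aP : forall j, P (a j).
Variable delta : R.
Hypothesis delta_gt0 : 0 < delta.
Hypothesis weight_ge_delta : forall q, P q -> exists j, delta <= weight (a j) q.

(** Need not be uniform: the mean is preserved for each choice of [j] separately, and only a
    positive lower bound on each probability matters. *)
Fixpoint pick (s : seq 'I_N.+1) : prog R n 'I_N.+1 :=
  if s is j :: s' then
    Flip (inr (fair R)) (fun b => if b then Ret j else pick s')
  else Ret ord0.

Lemma expect_pick_ge p s j (g : 'I_N.+1 -> R) : (forall k, 0 <= g k) -> j \in s ->
  2^-1 ^+ size s * g j <= expect p (pick s) g.
Proof.
move=> g0; have e0 s' : 0 <= expect p (pick s') g.
  elim: s' => [|k s' IH] //=; have := g0 k; lra.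
elim: s => [//|k s IH]; rewrite inE => /orP[/eqP<-|/IH {}IH] /=.
  have : 2^-1 ^+ (size s).+1 <= 2^-1 :> R.
    by rewrite exprS ler_piMr// exprn_ile1//; lra.
  by have := g0 j; have := e0 s; nra.
by rewrite exprS -mulrA; have := g0 k; lra.
Qed.

(* The state [x] lists the vertices pushed away from so far, most recent first; the round
   is balanced because [push v q - q] and [v - q] cancel after scaling by [weight v q]. *)
Definition round (x : seq 'I_N.+1) : prog R n (seq 'I_N.+1 + 'I_N.+1) :=
  bind (pick (enum 'I_N.+1)) (fun j =>
    Flip (inr (fair R)) (fun b =>
      if b then bind (product_test (a j) (index_enum 'I_n))
                     (fun ok => Ret (if ok then inr j else inl x))
      else Ret (inl (j :: x)))).

Fixpoint state_coin (x : seq 'I_N.+1) (i : 'I_n) : prog R n bool :=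
  if x is j :: x' then subst (state_coin x') (push_coin (a j) i)
  else Flip (inl i) Ret.

Definition state_point (p : 'rV[R]_n) (x : seq 'I_N.+1) : 'rV[R]_n :=
  foldr (fun j => push (a j)) p x.

(** The round is written for the original coins; substitution runs it at the current point
    [state_point p x]. *)
Definition body x := subst (state_coin x) (round x).

Lemma prob1_state_coin p x i : prob1 p (state_coin x i) = state_point p x 0 i.
Proof.
elim: x i => [|j x IH] i /=; first by rewrite /prob1 /=; ring.
by rewrite /prob1 (expect_subst _ _ IH) -prob1_push_coin//; exact: (aP j).1.
Qed.

(** The cube bounds come from the simulation, each coordinate being the probability of a program;
    [K] contains the line through [a j] and [q]. *)
Lemma push_polytope j q : P q -> P (push (a j) q).
Proof.
move=> Pq; split.
  move=> i; rewrite -prob1_push_coin; last exact: (aP j).1.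
  by apply: prob1_bound; exact: Pq.1.
by apply: affine_line; [|exact: (aP j).2|exact: Pq.2|exact: Pq.2].
Qed.

Lemma state_point_polytope p x : P p -> P (state_point p x).
Proof. by move=> Pp; elim: x => //= j x; apply: push_polytope. Qed.

Lemma expect_body p x g : expect p (body x) g =
  expect p (pick (enum 'I_N.+1)) (fun j => let w := weight (a j) (state_point p x) in
    2^-1 * (w * g (inr j) + (1 - w) * g (inl x)) + 2^-1 * g (inl (j :: x))).
Proof.
(* [pick] flips constant coins only, so its law does not depend on the input. *)
have pickE q s h : expect q (pick s) h = expect p (pick s) h.
  by elim: s => //= k s ->.
rewrite (expect_subst _ _ (prob1_state_coin p x)) /round expect_bind pickE.
apply: eq_expect => j /=; rewrite expect_bind expect_bool prob1_product_test /=.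
by rewrite -/(weight _ _); field.
Qed.

Section FixedInput.
Variable p : 'rV[R]_n.
Hypothesis Pp : P p.
Let pcube : unit_cube p := Pp.1.

(** Some point of weight at least [delta] is picked with probability at least [2^-1 ^+ N.+1], then
    tested with probability 1/2. *)
Lemma expect_body_stay x :
  expect p (body x) (fun y => if y is inl _ then 1 else 0) <=
    1 - 2^-1 ^+ N.+1 * (2^-1 * delta).
Proof.
have Pq := state_point_polytope x Pp; have [j jdelta] := weight_ge_delta Pq.
rewrite expect_body /=.
rewrite (@eq_expect _ _ _ _ _ _ (fun k => 1 + (-1) * (2^-1 * weight (a k) (state_point p x)))).
  rewrite expectD expect_cst expectZ mulN1r lerD2l lerN2.
  apply: le_trans (@expect_pick_ge _ _ j (fun k => 2^-1 * weight (a k) _) _ _).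
  - rewrite size_enum_ord ler_wpM2l ?exprn_ge0 ?invr_ge0// ler_wpM2l ?invr_ge0//.
  - by move=> k; rewrite mulr_ge0 ?invr_ge0//; apply: weight_ge0; exact: Pq.1.
  - by rewrite mem_enum.
by move=> k; field.
Qed.

Lemma body_fixpoint_eq0 B (h : seq 'I_N.+1 + 'I_N.+1 -> R) :
  (forall x, h (inl x) = expect p (body x) h) -> (forall j, h (inr j) = 0) ->
  (forall x, `|h (inl x)| <= B) -> forall x, h (inl x) = 0.
Proof.
apply: expect_fixpoint_eq0 pcube _ expect_body_stay.
by rewrite !mulr_gt0 ?exprn_gt0 ?invr_gt0.
Qed.

Lemma body_terminates acc x : run_value body p (fun=> 1) acc (Ret (inl x)) = 1.
Proof.
have b01 : forall b : bool, 0 <= (1 : R) <= 1 by rewrite ler01 lexx.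
pose h y : R := 1 + (-1) * run_value body p (fun=> 1) acc (Ret y).
suff /eqP : h (inl x) = 0 by rewrite /h mulN1r subr_eq0 => /eqP.
apply: (@body_fixpoint_eq0 1) => [{}x|j|{}x].
- by rewrite /h expectD expect_cst expectZ -run_value_state.
- by rewrite /h run_value_out// mulN1r subrr.
- have /andP[? ?] := run_value_bound body pcube b01 acc (Ret (inl x)).
  by rewrite /h mulN1r ger0_norm ?subr_ge0// lerBlDr lerDl.
Qed.

Let out j y := run_value body p (fun b => b%:R) (eq_op^~ j) (Ret y).

Let nat_bool01 (b : bool) : 0 <= (b%:R : R) <= 1.
Proof. by case: b; rewrite /= ?lexx ?ler01. Qed.

Let out01 j y : 0 <= out j y <= 1.
Proof. exact: run_value_bound. Qed.

Let out_inr j k : out j (inr k) = (k == j)%:R.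
Proof. by rewrite /out run_value_out. Qed.

(** The defect from 1 is preserved by rounds and zero on outputs, so [body_fixpoint_eq0] applies. *)
Lemma sum_out x : \sum_j out j (inl x) = 1.
Proof.
pose h y : R := 1 + (-1) * \sum_j out j y.
suff /eqP : h (inl x) = 0 by rewrite /h mulN1r subr_eq0 => /eqP.
apply: (@body_fixpoint_eq0 (1 + N.+1%:R)) => [{}x|k|{}x].
- rewrite /h expectD expect_cst expectZ expect_sum; congr (_ + _ * _).
  by apply: eq_bigr => j _; rewrite /out run_value_state.
- rewrite /h (bigD1 k)//= big1 => [|j jk]; rewrite out_inr ?eqxx ?(eq_sym k) ?(negPf jk)//.
  by rewrite addr0 mulr1 subrr.
- rewrite /h; apply: le_trans (ler_normD _ _) _; rewrite normr1 lerD2l mulN1r normrN.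
  apply: le_trans (ler_norm_sum _ _ _) _.
  rewrite -[N.+1 in leRHS]card_ord -sum1_card natr_sum; apply: ler_sum => j _.
  by have /andP[? ?] := out01 j (inl x); rewrite ger0_norm.
Qed.

(** Martingale argument: [val] follows a coordinate of the current point, then of the output, and
    its gap to the expected output is a bounded fixpoint. *)
Lemma sum_out_vertex i : \sum_j out j (inl [::]) * a j 0 i = p 0 i.
Proof.
pose val y := match y with inl x => state_point p x 0 i | inr j => a j 0 i end.
pose h y : R := val y + (-1) * \sum_j a j 0 i * out j y.
suff /eqP : h (inl [::]) = 0.
  by rewrite /h mulN1r subr_eq0 /= => /eqP ->; apply: eq_bigr => j _; rewrite mulrC.
apply: (@body_fixpoint_eq0 (1 + N.+1%:R)) => [x|k|x].
- rewrite /h expectD expectZ expect_sum; congr (_ + _ * _).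
    (* For each [j] alone, with q the current point and w its weight, (w a_j + (1 - w) q)/2 + (q + w
       (q - a_j))/2 = q. *)
    rewrite expect_body /= -[LHS](expect_cst p (pick (enum 'I_N.+1))).
    by apply: eq_expect => j /=; rewrite !mxE; field.
  by apply: eq_bigr => j _; rewrite expectZ /out run_value_state.
- rewrite /h (bigD1 k)//= big1 => [|j jk]; rewrite out_inr ?eqxx ?(eq_sym k) ?(negPf jk) ?mulr0//.
  by rewrite addr0 mulr1 mulN1r subrr.
- rewrite /h; apply: le_trans (ler_normD _ _) _; rewrite mulN1r normrN lerD//.
    by have /andP[? ?] := (state_point_polytope x Pp).1 i; rewrite ger0_norm.
  apply: le_trans (ler_norm_sum _ _ _) _.
  rewrite -[N.+1 in leRHS]card_ord -sum1_card natr_sum; apply: ler_sum => j _.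
  have /andP[? ?] := out01 j (inl x); have /andP[? ?] := (aP j).1 i.
  by rewrite ger0_norm ?mulr_ge0// mulr_ile1.
Qed.

End FixedInput.

(** All trees [F v] unfold the same machine and differ only in their leaf labels; injectivity of [a]
    identifies the label test with equality of indices. *)
Lemma factory_exists : injective a ->
  exists (F : 'rV[R]_n -> bf_tree R n) (f : 'rV[R]_n -> 'rV[R]_n -> R),
    (forall v, bf_implements (F v) (f v) P) /\
    (forall p, P p -> \sum_j f (a j) p = 1 /\ \sum_j f (a j) p *: a j = p).
Proof.
move=> a_inj.
pose F v := unfold_tree body (fun j => a j == v) (Ret (inl [::])).
pose f v p := value p (fun b => b%:R) (F v).
have nat_bool01 (b : bool) : 0 <= (b%:R : R) <= 1.
  by case: b; rewrite /= ?lexx ?ler01.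
have fE j p : f (a j) p =
    run_value body p (fun b => b%:R) (eq_op^~ j) (Ret (inl [::])).
  rewrite /f /run_value /F; congr (value _ _ (unfold_tree _ _ _)).
  by apply/funext => k; rewrite (inj_eq a_inj).
exists F, f; split=> [v|p Pp].
  split=> [|p Pp]; first exact: unfold_tree_wf.
  split.
    rewrite /bf_terminates stop_massE -[X in _ --> X](body_terminates Pp (fun j => a j == v) [::]).
    by apply: is_cvg_mass => [|b|]; [exact: Pp.1|rewrite ler01 lexx|exact: unfold_tree_wf].
  rewrite out1_massE.
  by apply: is_cvg_mass => [|b|]; [exact: Pp.1|exact: nat_bool01|exact: unfold_tree_wf].
split; first by under eq_bigr do rewrite fE; exact: sum_out.
apply/rowP => i; rewrite summxE -[RHS](sum_out_vertex Pp); apply: eq_bigr => j _.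
by rewrite mxE fE.
Qed.

End Factory.

(** * Uniform weight bound and assembly of the factory *)

Lemma polytope_weight_bound (R : realType) (n : nat) (K : set 'rV[R]_n)
    (vs : seq 'rV[R]_n) : affine_subspace K ->
  let P := @unit_cube R n `&` K in
  (forall v, v \in vs <-> is_vertex P v) ->
  exists2 delta : R, 0 < delta &
    forall q, P q -> exists2 v, v \in vs & delta <= weight v q.
Proof.
move=> affK P vsP.
have vcube v : v \in vs -> unit_cube v by move=> /vsP[[]].
(* Inverse of the distortion factor in [vertex_near]. *)
pose t : R := 2^-1 ^+ n.
have t01 : 0 < t <= 1 by rewrite exprn_gt0 ?invr_gt0// exprn_ile1//; lra.
(* [m] is the minimum of 1 and the finitely many diagonal weights, all positive. *)
have [m m0 mle] : exists2 m : R, 0 < m & forall v, v \in vs -> m <= weight v v.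
  elim: {vsP} vs vcube => [|v vs IH] vcube; first by exists 1.
  have [|m m0 mle] := IH; first by move=> w ws; apply: vcube; rewrite inE ws orbT.
  exists (Num.min m (weight v v)).
    by rewrite lt_min m0 weight_diag_gt0//; apply: vcube; rewrite inE eqxx.
  by move=> w; rewrite inE ge_min => /orP[/eqP->|/mle ->]; rewrite ?lexx ?orbT.
have T0 : 0 < (t ^+ 2) ^+ n by rewrite !exprn_gt0//; case/andP: t01.
exists ((t ^+ 2) ^+ n * m); first by rewrite mulr_gt0.
move=> q Pq; have [v vP vq] := vertex_near affK Pq.
have vvs : v \in vs by apply/vsP.
exists v => //; apply: (@le_trans _ _ ((t ^+ 2) ^+ n * weight v v)).
  by rewrite ler_pM2l//; exact: mle.
apply: weight_lower_bound => // [|i]; first exact: vcube.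
have [v1 v2] := vq i; split.
  by rewrite /t exprVn mulrC ler_pdivrMr ?exprn_gt0// mulrC.
by rewrite /t exprVn mulrC ler_pdivrMr ?exprn_gt0// mulrC.
Qed.

Theorem theorem4 (R : realType) (n : nat) (K : set 'rV[R]_n) :
  affine_subspace K ->
  let P := @unit_cube R n `&` K in
  exists (vs : seq 'rV[R]_n) (F : 'rV[R]_n -> bf_tree R n)
         (f : 'rV[R]_n -> 'rV[R]_n -> R),
    [/\ uniq vs,
        (forall v, v \in vs <-> is_vertex P v),
        (forall v, v \in vs -> bf_implements (F v) (f v) P) &
        (forall p, P p ->
           \sum_(v <- vs) f v p = 1 /\ \sum_(v <- vs) f v p *: v = p)].
Proof.
move=> affK P; have [vs vs_uniq vsP] := vertices_enum affK.
have [delta delta0 near_vertex] := polytope_weight_bound affK vsP.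
exists vs; case: vs => [|v0 vs] in vs_uniq vsP near_vertex *.
  (* Without vertices P is empty, since [near_vertex] would give a member of the empty list. *)
  exists (fun _ _ => BLeaf R n true), (fun _ _ => 0); split=> // p Pp.
  by have [] := near_vertex p Pp.
pose a j := tnth (in_tuple (v0 :: vs)) j.
have aP j : P (a j) by have /vsP[] := mem_tnth j (in_tuple (v0 :: vs)).
have a_near q : P q -> exists j, delta <= weight (a j) q.
  move=> /near_vertex[v /(tnthP (in_tuple (v0 :: vs)))[j ->] ?]; by exists j.
have a_inj : injective a by apply/tuple_uniqP.
have [F [f [Ff fP]]] := factory_exists affK aP delta0 a_near a_inj.
exists F, f; split=> // p Pp; rewrite !(big_tnth _ _ (v0 :: vs)); exact: fP.
Qed.
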